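(* Let $(S,R)$ be a compact flat surface with finitely many cone points $\Sigma\subset S$ and let $M=T_1(S\setminus\Sigma)$. Suppose that $(S,R)$ has non-rational holonomy (a condition that holds in particular if at least one of the cone angles is an irrational multiple of $2\pi$). Then the horizontal foliation $\mathcal F_H$ of $M$ is ergodic, that is, any function $u\in L^2(M,\mathrm{vol}_M)$ which is constant along almost every leaf of $\mathcal F_H$ is almost everywhere constant.
   Context: $S$ is a compact connected oriented surface with a flat metric $R$ having finitely many cone points, forming the finite set $\Sigma=\{p_1,\dots,p_\sigma\}$; the cone angle at $p_i$ is $2\pi(\alpha_i+1)$, $\alpha_i>-1$. $M=T_1(S\setminus\Sigma)$ is the unit tangent bundle. $X$ is the generator of the geodesic flow of $R$ on $M$, $Y$ is the generator of the orthogonal geodesic flow (parallel translation of $v$ along the geodesic with initial direction $v^\perp$, the rotation of $v$ by $+\pi/2$), and $\Theta$ is the generator of the rotations $\phi^\Theta_t$ in the fibers. In a local flat coordinate $x+iy$ on $S\setminus\Sigma$, with $\theta$ the angle of the unit vector, $X=\cos\theta\,\partial_x+\sin\theta\,\partial_y$, $Y=-\sin\theta\,\partial_x+\cos\theta\,\partial_y$, $\Theta=\partial_\theta$; hence $[X,Y]=0$, $[\Theta,X]=Y$, $[\Theta,Y]=-X$. The volume form is $\mathrm{vol}_M=\hat X\wedge\hat Y\wedge\hat\Theta$, where $\{\hat X,\hat Y,\hat\Theta\}$ is the coframe dual to $\{X,Y,\Theta\}$ (locally $dx\wedge dy\wedge d\theta$). The horizontal (holonomy) foliation $\mathcal F_H$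 is the foliation of $M$ tangent to the $2$-dimensional integrable distribution spanned by $X$ and $Y$; its leaves are the equivalence classes of unit tangent vectors under parallel transport for the flat metric along paths in $S\setminus\Sigma$. Since the metric is flat, parallel transport along loops defines the holonomy representation $\pi_1(S\setminus\Sigma)\to S^1$ (rotations of a fiber). The holonomy is non-rational if some element of $\pi_1(S\setminus\Sigma)$ acts by a rotation whose angle is an irrational multiple of $2\pi$. *)

(* Defs.v *)
From HB Require Import structures.
From mathcomp Require Import all_boot all_order all_algebra.
From mathcomp Require Import all_classical all_reals all_analysis.
From mathcomp Require Import ring lra.

Set Implicit Arguments.
Unset Strict Implicit.
Unset Printing Implicit Defensive.

Import Order.TTheory GRing.Theory Num.Theory.
Import numFieldNormedType.Exports.

Local Open Scope classical_set_scope.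
Local Open Scope ring_scope.

Section Plane.
Context {R : realType}.
Implicit Types (t : R) (z : R * R).

Definition rot t z : R * R :=
  (cos t * z.1 - sin t * z.2, sin t * z.1 + cos t * z.2).

Definition from_polar z : R * R := (z.1 * cos z.2, z.1 * sin z.2).

Lemma rot_rot s t z : rot s (rot t z) = rot (s + t) z.
Proof. by rewrite /rot cosD sinD /=; congr pair; ring. Qed.

Lemma rotC s t z : rot s (rot t z) = rot t (rot s z).
Proof. by rewrite !rot_rot addrC. Qed.

Lemma rot_0 z : rot 0 z = z.
Proof. by case: z => x y; rewrite /rot cos0 sin0 /=; congr pair; ring. Qed.

Lemma rot0 t : rot t 0 = 0.
Proof. by rewrite /rot /= !mulr0 subr0 addr0. Qed.

Lemma rotD t z z' : rot t (z + z') = rot t z + rot t z'.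
Proof. by rewrite /rot /=; congr pair => /=; ring. Qed.

Lemma rot_unit t z :
  (rot t z).1 ^+ 2 + (rot t z).2 ^+ 2 = z.1 ^+ 2 + z.2 ^+ 2.
Proof.
rewrite /rot /=.
transitivity ((cos t ^+ 2 + sin t ^+ 2) * (z.1 ^+ 2 + z.2 ^+ 2)); first by ring.
by rewrite cos2Dsin2 mul1r.
Qed.

End Plane.

Section Cone.
Context {R : realType}.

(* [c] is a system of polar coordinates [(r, t)], for [0 <= r < r0], around the
   point [p], in which the flat structure given by the charts is that of a
   Euclidean cone of total angle [angle]: [t] is only defined modulo [angle],
   and, where [0 < r], the charts are, up to a rotation and a translation, the
   developing map [(r cos t, r sin t)]. *)
Definition cone_coordinates (S : topologicalType) (sing : set S) (I : Type)
    (dom : I -> set S) (chart : I -> S -> R * R) (p : S) (angle r0 : R)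
    (c : R * R -> S) : Prop :=
  [/\ forall t, c (0, t) = p,
      {within [set z | 0 <= z.1 < r0], continuous c},
      forall r t, 0 < r < r0 -> ~ sing (c (r, t)),
      forall r t r' t', 0 < r < r0 -> 0 < r' < r0 ->
        c (r, t) = c (r', t') <-> r = r' /\ exists k : int, t' = t + k%:~R * angle
    & (forall i r t, 0 < r < r0 -> dom i (c (r, t)) ->
        exists a b, \forall z \near ((r, t) : R * R),
          chart i (c z) = rot a (from_polar z) + b) /\
      (forall r, 0 < r < r0 ->
        nbhs p (c @` [set z | 0 <= z.1 < r]))].

End Cone.

(* A compact connected oriented flat surface with finitely many cone points: the
   flat metric and the orientation on the complement of [sing] are given by an
   atlas of flat coordinates, whose changes of coordinates are locally of the
   form z |-> e^(it) z + b. *)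
Record flatSurface (R : realType) := FlatSurface {
  carrier :> topologicalType;
  sing : set carrier;
  alpha : carrier -> R;
  chart_index : Type;
  dom : chart_index -> set carrier;
  chart : chart_index -> carrier -> R * R;
  surface_nonempty : [set: carrier] !=set0;
  surface_hausdorff : hausdorff_space carrier;
  surface_compact : compact [set: carrier];
  surface_connected : connected [set: carrier];
  sing_finite : finite_set sing;
  dom_open : forall i, open (dom i);
  dom_cover : \bigcup_i dom i = ~` sing;
  chart_inj : forall i p q, dom i p -> dom i q -> chart i p = chart i q -> p = q;
  chart_continuous : forall i p, dom i p -> {for p, continuous (chart i)};
  chart_open : forall i (U : set carrier),
    open U -> U `<=` dom i -> open (chart i @` U);
  chart_transition : forall i j p, dom i p -> dom j p ->
    exists t b, \forall q \near p, chart j q = rot t (chart i q) + b;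
  alpha_gt : forall p, sing p -> - 1 < alpha p;
  sing_cone : forall p, sing p ->
    exists r0 c, 0 < r0 /\
      cone_coordinates sing dom chart p (2 * pi * (alpha p + 1)) r0 c
}.

Arguments sing {R} f.
Arguments alpha {R} f.
Arguments chart_index {R} f.
Arguments dom {R} f.
Arguments chart {R} f.

Definition cone_angle (R : realType) (F : flatSurface R) (p : F) : R :=
  2 * pi * (alpha F p + 1).

Section UnitTangent.
Context {R : realType} (F : flatSurface R).

(* The differential at [p] of the change of coordinates from chart [i] to chart
   [j] is the rotation of angle [t]. *)
Definition transition_angle (i j : chart_index F) (p : F) (t : R) : Prop :=
  exists b, \forall q \near p, chart F j q = rot t (chart F i q) + b.

(* [dir v i] is the expression of the vector [v] in the chart [i]; it is set to 0
   when the chart is not defined at the base point, so that equality of unit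
   tangent vectors is Leibniz equality. *)
Record unit_tangent := UnitTangent {
  base : F;
  dir : chart_index F -> R * R;
  base_regular : ~ sing F base;
  dir_unit : forall i, dom F i base -> (dir i).1 ^+ 2 + (dir i).2 ^+ 2 = 1;
  dir_out : forall i, ~ dom F i base -> dir i = 0;
  dir_transition : forall i j t, dom F i base -> dom F j base ->
    transition_angle i j base t -> dir j = rot t (dir i)
}.

Lemma transition_angle_uniq i j p s t z : dom F i p ->
  transition_angle i j p s -> transition_angle i j p t -> rot s z = rot t z.
Proof.
move=> ip [b hb] [c hc].
pose P q := rot s (chart F i q) + b = rot t (chart F i q) + c.
have hP : nbhs p P by near=> q; rewrite /P -(near hb q)// -(near hc q).
have : nbhs p (P `&` dom F i).
  by apply: filterI => //; apply: open_nbhs_nbhs; split => //; exact: dom_open.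
rewrite nbhsE => -[V [oV Vp] VP].
have oC : open (chart F i @` V) by apply: chart_open => // q /VP[].
have : nbhs (chart F i p) (chart F i @` V).
  by apply: open_nbhs_nbhs; split => //; exists p.
move=> /nbhs_ballP[e /= e0 be].
pose h : R * R := (e / 2, 0).
have [q Vq hq] : (chart F i @` V) (chart F i p + h).
  apply: be; split; rewrite /ball/= opprD addrA subrr add0r normrN ?normr0//.
  by rewrite gtr0_norm ?divr_gt0// ltr_pdivrMr// ltr_pMr// ltr1n.
have [Pq _] := VP _ Vq; have [Pp _] := VP _ Vp.
have {Pq Pp} : rot s h = rot t h.
  by move: Pq; rewrite /P hq !rotD addrAC Pp [in RHS]addrAC => /(@GRing.addrI _ _) ->.
have e2 : e / 2 != 0 by rewrite gt_eqF// divr_gt0.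
rewrite /rot /= !mulr0 !subr0 !addr0 => -[/(mulIf e2) -> /(mulIf e2) ->].
by [].
Unshelve. all: by end_near. Qed.

Lemma transition_angle_refl i p : transition_angle i i p 0.
Proof. by exists 0; near=> q; rewrite rot_0 addr0.
Unshelve. all: by end_near. Qed.

Lemma transition_angle_trans i j k p s t :
  transition_angle i j p s -> transition_angle j k p t ->
  transition_angle i k p (t + s).
Proof.
move=> [b hb] [c hc]; exists (rot t b + c); near=> q.
by rewrite (near hc q)// (near hb q)// rotD rot_rot addrA.
Unshelve. all: by end_near. Qed.

Lemma rotate_unit v a i : dom F i (base v) ->
  (rot a (dir v i)).1 ^+ 2 + (rot a (dir v i)).2 ^+ 2 = 1.
Proof. by move=> iv; rewrite rot_unit dir_unit. Qed.

Lemma rotate_out v a i : ~ dom F i (base v) -> rot a (dir v i) = 0.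
Proof. by move=> iv; rewrite dir_out// rot0. Qed.

Lemma rotate_transition v a i j t : dom F i (base v) -> dom F j (base v) ->
  transition_angle i j (base v) t -> rot a (dir v j) = rot t (rot a (dir v i)).
Proof. by move=> iv jv ht; rewrite (dir_transition iv jv ht) rotC. Qed.

(* The flow of Theta, the rotations in the fibres. *)
Definition rotate (a : R) (v : unit_tangent) : unit_tangent :=
  UnitTangent (base_regular (u:=v)) (@rotate_unit v a) (@rotate_out v a)
    (@rotate_transition v a).

Lemma exists_unit_tangent p : ~ sing F p -> exists v, base v = p.
Proof.
move=> Sp; have [i _ ip] : (\bigcup_i dom F i) p by rewrite dom_cover.
have tij j : exists t, dom F j p -> transition_angle i j p t.
  have [jp|jp] := pselect (dom F j p); last by exists 0.
  by have [t [b tb]] := chart_transition ip jp; exists t => _; exists b.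
have [a ha] := choice tij.
pose d j : R * R := if `[< dom F j p >] then rot (a j) (1, 0) else 0.
have dE j : dom F j p -> d j = rot (a j) (1, 0) by move=> jp; rewrite /d asboolT.
have d1 j : dom F j p -> (d j).1 ^+ 2 + (d j).2 ^+ 2 = 1.
  by move=> jp; rewrite dE// rot_unit /= expr1n expr0n addr0.
have d0 j : ~ dom F j p -> d j = 0 by move=> jp; rewrite /d asboolF.
have dT j k t : dom F j p -> dom F k p -> transition_angle j k p t ->
    d k = rot t (d j).
  move=> jp kp jk; rewrite !dE// rot_rot; apply: transition_angle_uniq ip _ _.
    exact: ha.
  exact: transition_angle_trans (ha _ jp) jk.
by exists (UnitTangent Sp d1 d0 dT).
Qed.

Lemma exists_regular : exists p, ~ sing F p.
Proof.
have [p _] := surface_nonempty F.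
have [Sp|] := pselect (sing F p); last by exists p.
have [r0 [c [r00 [_ _ cS _ _]]]] := sing_cone Sp.
by exists (c (r0 / 2, 0)); apply: cS; rewrite divr_gt0//= ltr_pdivrMr// ltr_pMr// ltr1n.
Qed.

Definition some_unit_tangent : unit_tangent :=
  projT1 (cid (exists_unit_tangent (projT2 (cid exists_regular)))).

HB.instance Definition _ := gen_eqMixin unit_tangent.
HB.instance Definition _ := gen_choiceMixin unit_tangent.
HB.instance Definition _ := isPointed.Build unit_tangent some_unit_tangent.

(* The set [A] of unit tangent vectors read in the local coordinates
   [((x, y), theta)] above the chart [i]. *)
Definition in_coordinates (i : chart_index F) (A : set unit_tangent) :
    set (R * R * R) :=
  [set z | exists v, [/\ A v, dom F i (base v), chart F i (base v) = z.1
                      & dir v i = (cos z.2, sin z.2)]].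

(* The manifold topology of the unit tangent bundle and its Borel sets. *)
Definition tangent_open : set (set unit_tangent) :=
  [set A | forall i, open (in_coordinates i A)].

Definition tangent_borel : Type := g_sigma_algebraType tangent_open.

HB.instance Definition _ := Measurable.on tangent_borel.

(* [vol] is the volume measure, locally dx dy dtheta; an angle is counted once by
   restricting it to [0, 2 pi[. *)
Definition is_volume (vol : set tangent_borel -> \bar R) : Prop :=
  forall i (A : set tangent_borel), measurable A ->
    A `<=` [set v | dom F i (base v)] ->
    vol A = ((lebesgue_measure \x lebesgue_measure) \x lebesgue_measure)%E
      (in_coordinates i A `&` [set z | 0 <= z.2 < 2 * pi]).

Definition regular_path (g : R -> F) : Prop :=
  {within `[0, 1], continuous g} /\ {in `[0, 1], forall s, ~ sing F (g s)}.

(* [w] is the parallel transport of [v] along [g]: a field [V] along [g] is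
   parallel when its expressions in the flat coordinates are locally constant. *)
Definition parallel_transport (g : R -> F) (v w : unit_tangent) : Prop :=
  exists V : R -> unit_tangent,
    [/\ V 0 = v, V 1 = w,
        {in `[0, 1], forall s, base (V s) = g s}
      & {in `[0, 1], forall s i, dom F i (g s) ->
          \forall s' \near s, s' \in `[0, 1] -> dir (V s') i = dir (V s) i}].

Definition horizontal_leaf (v : unit_tangent) : set unit_tangent :=
  [set w | exists g, regular_path g /\ parallel_transport g v w].

(* The holonomy of the loop [g] is the rotation of angle [a]. Since the metric is
   flat, it only depends on the class of [g] in the fundamental group of the
   complement of [sing]. *)
Definition holonomy (g : R -> F) (a : R) : Prop :=
  forall v, base v = g 0 -> parallel_transport g v (rotate a v).

Definition non_rational_holonomy : Prop :=
  exists g a, [/\ regular_path g, g 0 = g 1, holonomy g a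
                & irrational (a / (2 * pi))].

(* The elements of L^2 are classes of functions modulo equality almost
   everywhere, hence the representative [u']. The vectors excluded by the second
   condition form the union of the leaves along which [u'] is not constant. *)
Definition constant_on_ae_leaf (vol : {measure set tangent_borel -> \bar R})
    (u : tangent_borel -> R) : Prop :=
  exists2 u' : tangent_borel -> R, {ae vol, forall v, u v = u' v} &
    {ae vol, forall v, forall w, horizontal_leaf v w -> u' w = u' v}.

Definition horizontal_ergodic (vol : {measure set tangent_borel -> \bar R}) :
    Prop :=
  forall u : tangent_borel -> R, u \in Lfun vol 2%:E ->
    constant_on_ae_leaf vol u -> exists k, {ae vol, forall v, u v = k}.

End UnitTangent.

(* Main.v *)
Require Import Defs.
From mathcomp Require Import all_boot all_order all_algebra.
From mathcomp Require Import all_classical all_reals all_analysis.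
From mathcomp Require Import measurable_realfun ring lra.
(* so that [rot] denotes the rotation of the plane, not that of sequences *)
Import Defs.

Import Order.TTheory GRing.Theory Num.Theory.
Import numFieldNormedType.Exports.

(** Why the horizontal foliation is ergodic.

    A function that is constant on almost every leaf agrees almost everywhere
    with a function [f] that is constant on every leaf: the exceptional vectors
    form a union of leaves, on which the value can be reset to 0
    ([leaf_invariant_representative]).  Such an [f] is determined by its values
    on one circle, a fibre over a regular point [p0].  Indeed the surface stays
    connected by paths once the cone points are removed, so parallel transport
    identifies the fibre over [p0] with any other fibre, by a rotation
    ([leaf_over_regular], [leaf_rotate]).  On that circle [f] is invariant under
    the rotation of angle [a] given by the holonomy of a loop based at [p0], and
    [a / (2 * pi)] is irrational for a suitable loop.  Ergodicity of irrational
    rotations then makes [f] constant almost everywhere on the circle, and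
    Fubini spreads the constant over the whole unit tangent bundle.

    Ergodicity of the rotation is proved on the line, where the periods [2 * pi]
    and [a] generate a dense subgroup ([irrational_dense]).  If a measurable set
    [A] is preserved, up to null sets, by a dense set of translations, then the
    measure of [A] in a ball depends only on the radius ([le_measure_ball]).
    Hence two points at which the density of [A] is given by its indicator lie
    both in [A] or both outside [A]; by the Lebesgue density theorem, applied to
    the superlevel sets at rational heights, an almost periodic function is
    constant almost everywhere ([almost_periodic_ae_constant]).

    The passage between the bundle and its fibres uses flat boxes: around a
    regular point a leaf is a horizontal slice of a product of a disc and a
    circle ([flat_box]), and a set over a chart is null if and only if it meets
    almost every fibre in a null set ([volume_null]).  This is used twice: to
    find one fibre near [p0] on which the given measurable function equals [f]
    almost everywhere, so that [f] restricted to the circle is almost measurable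
    ([ae_fibre_measurable]), and to deduce that the exceptional set is null over
    every flat box ([ae_constant_of_fibres]).  Compactness of the surface reduces
    the global statement to this local one; a punctured neighbourhood of a cone
    point is a countable union of compact sets of regular points.

    A cone point of irrational angle gives non-rational holonomy because, in
    polar coordinates around it, the vector field that is constant in the
    developing map is parallel and is rotated by minus the cone angle after one
    turn ([frame_turn], [non_rational_cone]). *)

Set Implicit Arguments.
Unset Strict Implicit.

Local Open Scope classical_set_scope.
Local Open Scope ring_scope.

(** * Almost periodic functions on the real line *)

Section AlmostEverywhere.
Context {R : realType} d (T : measurableType d) (mu : {measure set T -> \bar R}).
Implicit Types P Q : T -> Prop.

Lemma ae_imp P Q : (forall x, P x -> Q x) ->
  {ae mu, forall x, P x} -> {ae mu, forall x, Q x}.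
Proof. by move=> PQ; apply: filterS. Qed.

Lemma ae_imp2 P Q (P' : T -> Prop) : (forall x, P x -> P' x -> Q x) ->
  {ae mu, forall x, P x} -> {ae mu, forall x, P' x} -> {ae mu, forall x, Q x}.
Proof. by move=> PQ; apply: filterS2. Qed.

End AlmostEverywhere.

Section RealLine.
Context {R : realType}.
Implicit Types (e h r t x y : R) (A : set R).
Local Notation mu := (@lebesgue_measure R).

Lemma measurable_shift h : measurable_fun [set: R] (fun t : R => t + h).
Proof. by apply: measurable_funD => //; exact: measurable_cst. Qed.

Lemma lebesgue_measure_shift h A : measurable A ->
  mu ((fun t => t + h) @^-1` A) = mu A.
Proof.
move=> mA; apply/esym.
pose s : R -> R := fun t => t + h.
have ms : measurable_fun [set: R] s by exact: measurable_shift.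
rewrite (@lebesgue_measure_unique R
  (pushforward mu (s : measurableTypeR R -> measurableTypeR R)))//.
move=> X [[b c] /= _ <-].
rewrite /pushforward.
have -> : s @^-1` `]b, c] = `](b - h), (c - h)]%classic.
  by apply/seteqP; split => t /=; rewrite /s !in_itv/= ltrBlDr lerBrDr.
by rewrite !lebesgue_measure_itv/= !lte_fin ltrD2r; case: ifP => // _;
  rewrite -EFinB; congr EFin; ring.
Qed.

Lemma ae_shift h (P : R -> Prop) :
  {ae mu, forall t, P t} -> {ae mu, forall t, P (t + h)}.
Proof.
move=> [N [mN N0 PN]]; exists ((fun t => t + h) @^-1` N); split.
- by rewrite -[X in measurable X]setTI; exact: measurable_shift.
- by rewrite lebesgue_measure_shift.
- by move=> t /= nP; apply: PN.
Qed.

(** Only one inclusion is asked for: where an equality of measures is needed, the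
    other inequality comes from exchanging the two points. *)
Definition almost_period A h := {ae mu, forall t, A t -> A (t + h)}.

Definition dense_almost_periods A := forall x y e, 0 < e ->
  exists2 h, almost_period A h & `|x + h - y| < e.

(** A translation that almost preserves [A] moves [ball x r] to a ball whose
    centre is as close to [y] as desired, hence one that exceeds [ball y r] by
    arbitrarily little. *)
Lemma le_measure_ball A x y r : dense_almost_periods A ->
  measurable A -> 0 < r -> (mu (A `&` ball x r) <= mu (A `&` ball y r))%E.
Proof.
move=> Ax mA r0; apply/lee_addgt0Pr => e e0.
have e40 : 0 < e / 4 by lra.
have [h [N [mN N0 AN]] he] := Ax x y _ e40.
have mb z s : measurable (ball z s : set R) by exact: measurable_ball.
have ms : measurable_fun [set: R] (fun t : R => t + h) by exact: measurable_shift.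
have mI z s : measurable (A `&` ball z s) by exact: measurableI.
have mb2 : measurable (ball (y - r) (e / 4) `|` ball (y + r) (e / 4) : set R).
  exact: measurableU.
have mp B : measurable B -> measurable ((fun t : R => t + h) @^-1` B).
  by move=> mB; rewrite -[X in measurable X]setTI; exact: ms.
apply: (@le_trans _ _ (mu ((fun t : R => t + h) @^-1` (A `&` ball (x + h) r) `|` N))).
  apply: le_measure; rewrite ?inE //; first exact: mI.
    by apply: measurableU; [exact: mp|exact: mN].
  move=> t [At xt].
  have [Nt|nNt] := pselect (N t); [by right|left; split => /=].
    by apply: contra_notP nNt => nA; apply: AN => /(_ At).
  by rewrite /ball/= opprD addrACA subrr addr0.
rewrite measureU0//; last by apply: mp; exact: mI.
apply: (@le_trans _ _ (mu (A `&` ball (x + h) r))).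
  by rewrite le_eqVlt; apply/orP; left; apply/eqP; apply: lebesgue_measure_shift; exact: mI.
(* what a ball of radius r with centre within e / 4 of y adds to ball y r lies in
   two balls of radius e / 4 around the end points, each of length e / 2 *)
have h4 : (e%:E = mu (ball (y - r)%R (e / 4)%R) + mu (ball (y + r)%R (e / 4)%R))%E.
  by rewrite !lebesgue_measure_ball ?(ltW e40)// -EFinD; congr EFin; rewrite mulr2n; lra.
apply: (@le_trans _ _ (mu ((A `&` ball y r) `|`
    (ball (y - r) (e / 4) `|` ball (y + r) (e / 4))))).
  apply: le_measure; rewrite ?inE; first exact: mI.
    by apply: measurableU; [exact: mI|exact: mb2].
  move=> t [At xt]; have [yt|yt] := pselect (ball y r t); [by left|right].
  move: he xt yt; rewrite /ball/= => /ltr_normlP[h1 h2] /ltr_normlP[h3 h5] /negP.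
  rewrite -leNgt ler_normr => /orP[yt|yt]; [left|right];
    apply/ltr_normlP; split; lra.
rewrite h4.
apply: (le_trans (measureU2 _ _ _)); [exact: mI|exact: mb2|].
by apply: leeD2l; apply: measureU2; exact: mb.
Qed.

(** The quotients whose limits are [\1_A x] and [\1_A y] are the same function of
    the radius, by [le_measure_ball]. *)
Lemma density_points_agree A x y : dense_almost_periods A ->
  measurable A ->
  (mu (A `&` ball x r) * (mu (ball x r))^-1)%E @[r --> 0^'+] --> (\1_A x)%:E ->
  (mu (A `&` ball y r) * (mu (ball y r))^-1)%E @[r --> 0^'+] --> (\1_A y)%:E ->
  A x -> A y.
Proof.
move=> Adense mA cx cy Ax.
suff e : (\1_A x)%:E = (\1_A y)%:E :> \bar R.
  move: e; rewrite !indicE mem_set// => -[]/eqP.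
  by case: (boolP (y \in A)) => [/set_mem//|]; rewrite oner_eq0.
apply: (@cvg_unique _ (@ereal_hausdorff R) _ _ _ _ cx).
apply: cvg_trans cy; apply: near_eq_cvg; near=> r.
have r0 : 0 < r by [].
rewrite !lebesgue_measure_ball ?ltW//; congr (_ * _)%E.
apply/eqP; rewrite eq_le; apply/andP; split; exact: le_measure_ball.
Unshelve. all: by end_near. Qed.

(** Almost every point is a density point, in the sense of
    [density_points_agree], of all the sets [g > q] with [q] rational; at two such
    points [g] lies above the same rationals. *)
Lemma almost_periodic_ae_constant (g : R -> R) : measurable_fun [set: R] g ->
  (forall x y e, 0 < e ->
     exists2 h, {ae mu, forall t, g (t + h) = g t} & `|x + h - y| < e) ->
  exists k, {ae mu, forall t, g t = k}.
Proof.
move=> mg gdense.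
pose A (q : rat) : set R := [set t | ratr q < g t].
have mA q : measurable (A q).
  have -> : A q = g @^-1` `]ratr q, +oo[.
    by apply/seteqP; split => t /=; rewrite in_itv/= andbT.
  by rewrite -[X in measurable X]setTI; apply: mg => //; exact: measurable_itv.
have Ad q : dense_almost_periods (A q).
  move=> x y e /(gdense x y)[h gh he]; exists h => //.
  by apply: ae_imp gh => t gt; rewrite /A/= gt.
pose L := [set x : R | forall q, (mu (A q `&` ball x r) * (mu (ball x r))^-1)%E
                      @[r --> 0^'+] --> (\1_(A q) x)%:E].
have aeL : {ae mu, forall t, L t}.
  have : {ae mu, forall x n, if unpickle n is Some q then
      (mu (A q `&` ball x r) * (mu (ball x r))^-1)%E @[r --> 0^'+] --> (\1_(A q) x)%:E
      else True}.
    apply: ae_foralln => n; case: (unpickle n) => [q|]; last exact: aeW.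
    exact: lebesgue_density.
  by apply: ae_imp => x Lx q; have := Lx (pickle q); rewrite pickleK.
have le_g x y : L x -> L y -> g x <= g y.
  move=> Lx Ly; rewrite leNgt; apply/negP => /rat_in_itvoo[q].
  rewrite in_itv/= => /andP[q1 q2].
  have := density_points_agree (Ad q) (mA q) (Lx q) (Ly q) q2.
  by rewrite /A/= ltNge (ltW q1).
have [x0 Lx0] : exists x, L x.
  have muT : (0 < mu [set: R])%E.
    apply: (@lt_le_trans _ _ (mu (ball (0 : R) 1))).
      by rewrite lebesgue_measure_ball// lte_fin.
    by apply: le_measure; rewrite ?inE//; exact: measurable_ball.
  by have := @filter_ex _ _ (ae_properfilter_algebraOfSetsType muT) L aeL.
exists (g x0); apply: ae_imp aeL => t Lt.
by apply/eqP; rewrite eq_le !le_g.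
Qed.

End RealLine.

(** * Dense subgroups of the real line *)

Section Dense.
Context {R : realType}.
Implicit Types (a b e s x y z : R) (G : set R).

Lemma subgroupMz G z (k : int) : G 0 -> (forall x y, G x -> G y -> G (x - y)) ->
  G z -> G (k%:~R * z).
Proof.
move=> G0 GB Gz.
have Gn (n : nat) : G (n%:R * z).
  elim: n => [|n IHn]; first by rewrite mul0r.
  have -> : n.+1%:R * z = n%:R * z - (0 - z) by rewrite -natr1; ring.
  exact/GB/GB.
case: k => n; first exact: Gn.
have -> : (Negz n)%:~R * z = 0 - n.+1%:R * z by rewrite NegzE mulrNz mulNr sub0r.
exact/GB/Gn.
Qed.

(** Euclidean division by [s]: the remainder is in [G] and smaller than [s]. *)
Lemma subgroup_generator G s : G 0 -> (forall x y, G x -> G y -> G (x - y)) ->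
  0 < s -> G s -> (forall z, G z -> 0 < z -> s <= z) ->
  forall z, G z -> exists k : int, z = k%:~R * s.
Proof.
move=> G0 GB s0 Gs sle z Gz; exists (Num.floor (z / s)).
have /andP[l u] := floor_itv (z / s).
rewrite ler_pdivlMr// in l; rewrite ltr_pdivrMr// intrD mulrDl mul1r in u.
set k := Num.floor (z / s) in l u *.
have Gr := GB _ _ Gz (subgroupMz k G0 GB Gs).
apply/eqP; rewrite -subr_eq0 eq_le subr_ge0 l andbT leNgt; apply/negP => r0.
have := sle _ Gr r0; lra.
Qed.

(** A subgroup of the line is cyclic or dense: if it had no arbitrarily small
    positive element, the infimum of its positive elements would be its least
    positive element, and a generator. *)
Lemma dense_subgroup G : G 0 -> (forall x y, G x -> G y -> G (x - y)) ->
  (exists2 z, G z & 0 < z) ->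
  (forall s, exists2 z, G z & forall k : int, z <> k%:~R * s) ->
  forall x y e, 0 < e -> exists2 h, G h & `|x + h - y| < e.
Proof.
move=> G0 GB [z0 Gz0 z00] Gncyc.
pose P := G `&` [set z | 0 < z].
have infP : has_inf P by split; [exists z0|exists 0 => z [_ /ltW]].
have small e : 0 < e -> exists2 g, G g & 0 < g < e.
  move=> e0; apply: contrapT => noG.
  have eP : lbound P e.
    move=> z [Gz z1]; rewrite leNgt; apply/negP => ze; apply: noG.
    by exists z => //; apply/andP.
  have s0 : 0 < inf P by apply: lt_le_trans e0 _; apply: lb_le_inf => //; exists z0.
  have infle z : P z -> inf P <= z by move=> Pz; apply: ge_inf => //; exact: infP.2.
  (* otherwise two elements of P would differ by less than inf P *)
  have Ps : P (inf P).
    have [g Pg gs] := inf_adherent s0 infP.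
    have [->//|ng] := eqVneq (inf P) g.
    have sg : 0 < g - inf P by rewrite subr_gt0 lt_neqAle ng infle.
    have [g' Pg' gs'] := inf_adherent sg infP.
    rewrite addrC subrK in gs'.
    have gg' : 0 < g - g' by rewrite subr_gt0.
    have := infle _ (conj (GB _ _ Pg.1 Pg'.1) gg'); have := infle _ Pg'; lra.
  have [z Gz zn] := Gncyc (inf P).
  have Ple y : G y -> 0 < y -> inf P <= y by move=> Gy y0; exact: infle.
  have [k zk] := subgroup_generator G0 GB s0 Ps.1 Ple Gz.
  exact: zn zk.
move=> x y e e0; have [g Gg /andP[g0 ge]] := small e e0.
exists ((Num.floor ((y - x) / g))%:~R * g); first exact: (subgroupMz _ G0 GB Gg).
have /andP[l u] := floor_itv ((y - x) / g).
rewrite ler_pdivlMr// in l; rewrite ltr_pdivrMr// intrD mulrDl mul1r in u.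
apply/ltr_normlP; split; lra.
Qed.

Lemma irrational_dense a b : 0 < b -> irrational (a / b) ->
  forall x y e, 0 < e ->
    exists m n : int, `|x + (m%:~R * a + n%:~R * b) - y| < e.
Proof.
move=> b0 irr x y e e0.
pose G : set R := [set z | exists m n : int, z = m%:~R * a + n%:~R * b].
have [||||h [m [n ->]] he] := @dense_subgroup G _ _ _ _ x y e e0.
- by exists 0, 0; rewrite !mul0r addr0.
- move=> _ _ [m [n ->]] [m' [n' ->]]; exists (m - m'), (n - n').
  by rewrite !intrB; ring.
- by exists b => //; exists 0, 1; rewrite mul0r add0r mul1r.
- move=> s; apply: contrapT => nG.
  have Gs z : G z -> exists k : int, z = k%:~R * s.
    move=> Gz; apply: contrapT => nz; apply: nG; exists z => // k zk.
    by apply: nz; exists k.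
  have [|k ak] := Gs a; first by exists 1, 0; rewrite mul1r mul0r addr0.
  have [|l bl] := Gs b; first by exists 0, 1; rewrite mul1r mul0r add0r.
  apply: irr; exists (k%:~R / l%:~R) => //.
  rewrite fmorph_div/= !ratr_int ak bl.
  have s0 : s != 0 by apply: contraTneq b0 => s0; rewrite bl s0 mulr0 ltxx.
  by rewrite -mulf_div divff// mulr1.
- by exists m, n.
Qed.

Local Notation mu := (@lebesgue_measure R).

(** Ergodicity of an irrational rotation of the circle, written for periodic
    functions on the line.  The periods are exact for [f]; its measurable
    version [g] inherits them up to null sets, which is what
    [almost_periodic_ae_constant] asks for. *)
Lemma ae_constant_of_irrational_periods (f g : R -> R) a b : 0 < b -> irrational (a / b) ->
  (forall t, f (t + a) = f t) -> (forall t, f (t + b) = f t) ->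
  measurable_fun [set: R] g -> {ae mu, forall t, f t = g t} ->
  exists k, {ae mu, forall t, f t = k}.
Proof.
move=> b0 irr fa fb mg fg.
pose per h := forall t, f (t + h) = f t.
have pB x y : per x -> per y -> per (x - y).
  by move=> px py t; rewrite -(py (t + (x - y))) -addrA subrK px.
have p0 : per 0 by move=> t; rewrite addr0.
have [|k gk] := almost_periodic_ae_constant mg; last first.
  by exists k; apply: ae_imp2 fg gk => t -> ->.
move=> x y e e0; have [m [n he]] := irrational_dense b0 irr x y e0.
exists (m%:~R * a + n%:~R * b) => //.
have ph : per (m%:~R * a + n%:~R * b).
  move=> t; rewrite addrA.
  have /(_ n b fb)-> := fun k z => @subgroupMz per z k p0 pB.
  by have /(_ m a fa)-> := fun k z => @subgroupMz per z k p0 pB.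
by apply: ae_imp2 fg (ae_shift (m%:~R * a + n%:~R * b) fg) => t <- <-.
Qed.

End Dense.

(** * Topological preliminaries and rotations of the plane *)

Section TopologicalPreliminaries.

Lemma within_continuous_near (T U : topologicalType) (A : set T) (f : T -> U) x (B : set U) :
  {within A, continuous f} -> A x -> nbhs (f x) B ->
  \forall y \near x, A y -> B (f y).
Proof.
move=> cf Ax Bfx.
have := cf x _ Bfx; rewrite /nbhs/= -nbhs_subspace_in//.
Qed.

Lemma within_continuous_comp (S T U : topologicalType) (A : set T) (f : T -> U) (h : S -> T) :
  {within A, continuous f} -> continuous h -> (forall s, A (h s)) ->
  continuous (f \o h).
Proof.
move=> cf ch Ah s B fB; suff : \forall s' \near s, B (f (h s')) by [].
have : \forall s' \near s, A (h s') -> B (f (h s')).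
  exact: ch s _ (within_continuous_near cf (Ah s) fB).
by apply: filterS => s'; apply.
Qed.

(** If [G K] failed, the sets whose complement in [K] satisfies [G] would form a
    proper filter containing [K] but without cluster point in [K]. *)
Lemma compact_local_property (T : topologicalType) (G : set T -> Prop) (K : set T) :
  G set0 -> (forall A B, A `<=` B -> G B -> G A) ->
  (forall A B, G A -> G B -> G (A `|` B)) ->
  compact K -> (forall x, K x -> exists2 U, nbhs x U & G U) -> G K.
Proof.
move=> G0 GS GU cK Kloc; apply: contrapT => nGK.
pose F : set_system T := [set B | G (K `\` B)].
have FF : ProperFilter F.
  apply: Build_ProperFilter_ex => [B FB|].
    apply: contrapT => nB; apply: nGK; apply: GS FB => x Kx; split => // Bx.
    by apply: nB; exists x.
  split; rewrite /F/=.
  - by rewrite setDT.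
  - by move=> B C GB GC; have := GU _ _ GB GC; rewrite -setDIr.
  - by move=> B C BC; apply: GS => x [Kx nC]; split => // /BC.
have [|x [Kx]] := cK F; first by rewrite /F/= setDv.
have [U Ux GU'] := Kloc _ Kx.
move=> /(_ (~` U) U); case=> //; last by move=> y [].
by apply: GS GU' => y [_]; rewrite /setC/= => /contrapT.
Qed.

End TopologicalPreliminaries.

Section Clamp.
Context {R : realType}.
Implicit Types s : R.

(** Precomposing with [clamp01] turns a path defined on the unit interval into
    one that is continuous on the whole line. *)
Definition clamp01 s : R := Num.max 0 (Num.min 1 s).

Lemma continuous_clamp01 : continuous clamp01.
Proof.
move=> s; apply: continuous_max; first exact: cst_continuous.
by apply: continuous_min; first exact: cst_continuous.
Qed.

Lemma clamp01_itv s : 0 <= clamp01 s <= 1.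
Proof. by rewrite /clamp01 le_max ge_max lexx ler01 ge_min lexx. Qed.

Lemma clamp010 : clamp01 0 = 0.
Proof. by rewrite /clamp01 (min_idPr ler01) maxxx. Qed.

Lemma clamp011 : clamp01 1 = 1.
Proof. by rewrite /clamp01 minxx (max_idPr ler01). Qed.

Lemma continuous_pair (f g : R -> R) : continuous f -> continuous g ->
  continuous (fun s => (f s, g s) : R * R).
Proof. by move=> cf cg s; exact: cvg_pair (cf s) (cg s). Qed.

End Clamp.

Section PlaneRotations.
Context {R : realType}.
Implicit Types (a b r t : R) (z : R * R).

Definition unit_vec t : R * R := (cos t, sin t).

Lemma rot_unit_vec a t : rot a (unit_vec t) = unit_vec (t + a).
Proof. by rewrite /rot /unit_vec/= addrC cosD sinD; congr pair; ring. Qed.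

Lemma rotK a z : rot (- a) (rot a z) = z.
Proof. by rewrite rot_rot addNr rot_0. Qed.

Lemma rot_inj a z z' : rot a z = rot a z' -> z = z'.
Proof. by move=> e; rewrite -(rotK a z) e rotK. Qed.

Lemma unit_vec_surj z : z.1 ^+ 2 + z.2 ^+ 2 = 1 -> exists t, z = unit_vec t.
Proof.
move=> z1.
have z1b : -1 <= z.1 <= 1.
  rewrite -ler_norml -(@ler_pXn2r _ 2)// ?nnegrE// expr1n.
  by rewrite real_normK ?num_real// -z1 lerDl sqr_ge0.
have s2 : Num.sqrt (1 - z.1 ^+ 2) = `|z.2| by rewrite -z1 addrAC subrr add0r sqrtr_sqr.
have [z2|z2] := leP 0 z.2.
  exists (acos z.1); rewrite /unit_vec acosK ?in_itv// sin_acos// s2 ger0_norm//.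
  by case: z {z1 z1b s2 z2}.
exists (- acos z.1); rewrite /unit_vec cosN sinN acosK ?in_itv// sin_acos// s2.
by rewrite ltr0_norm// opprK; case: z {z1 z1b s2 z2}.
Qed.

Lemma from_polarD r t h : from_polar (r + h, t) = from_polar (r, t) + (h * cos t, h * sin t).
Proof. by rewrite /from_polar/= !mulrDl. Qed.

Lemma from_polar_rot r t a : from_polar (r, t + a) = rot a (from_polar (r, t)).
Proof. by rewrite /from_polar /rot/= cosD sinD; congr pair; ring. Qed.

Lemma near_radial r t (P : R * R -> Prop) : (\forall z \near ((r, t) : R * R), P z) ->
  P (r, t) /\ exists2 h, h != 0 & P (r + h, t).
Proof.
move=> nP; split; first exact: nbhs_singleton nP.
move/nbhs_ballP: nP => [e /= e0 be]; exists (e / 2); first by rewrite gt_eqF// divr_gt0.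
apply: be; split => /=; last exact: ballxx.
by rewrite /ball/= opprD addrA subrr add0r normrN gtr0_norm ?divr_gt0//; lra.
Qed.

(** Comparing the two developing maps at two points of the same ray determines
    the image of the direction of the ray, hence the rotation. *)
Lemma polar_chart_unique r t a a' (b b' : R * R) :
  (\forall z \near ((r, t) : R * R),
     rot a (from_polar z) + b = rot a' (from_polar z) + b') ->
  unit_vec a = unit_vec a'.
Proof.
move=> /near_radial[e0 [h h0]]; rewrite from_polarD !rotD -!addrA.
rewrite ![rot _ (h * _, _) + _]addrC !addrA e0 => /addrI.
have -> : (h * cos t, h * sin t) = (h *: unit_vec t) :> R * R by [].
have rotZ s z : rot s (h *: z) = h *: rot s z.
  by rewrite /rot; congr pair => /=; rewrite /GRing.scale/=; ring.
rewrite !rotZ => /(scalerI h0); rewrite !rot_unit_vec.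
by rewrite ![t + _]addrC -!rot_unit_vec => /rot_inj.
Qed.

End PlaneRotations.

(** * Unit tangent vectors and horizontal leaves *)

Section UnitTangentVectors.
Context {R : realType} (F : flatSurface R).
Implicit Types (v w : unit_tangent F) (i j : chart_index F) (p q : F) (a b t : R).

Lemma near_dom i p : dom F i p -> \forall q \near p, dom F i q.
Proof. by move=> ip; apply: open_nbhs_nbhs; split => //; exact: dom_open. Qed.

Lemma exists_chart p : ~ sing F p -> exists i, dom F i p.
Proof.
move=> Sp; have [i _ ip] : (\bigcup_i dom F i) p by rewrite dom_cover.
by exists i.
Qed.

(** A unit tangent vector is determined by its expression in a single chart,
    since the expressions in the other charts are given by the transition
    rotations. *)
Lemma unit_tangent_eq v w i : base v = base w -> dom F i (base v) ->
  dir v i = dir w i -> v = w.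
Proof.
move=> bvw iv dvw.
have {}dvw : dir v = dir w.
  apply/funext => j; have [jv|jv] := pselect (dom F j (base v)); last first.
    by rewrite !dir_out// -bvw.
  have [t tij] := chart_transition iv jv.
  rewrite (dir_transition iv jv tij) dvw; apply/esym/dir_transition => //;
    by rewrite -bvw.
case: v w => [p d h1 h2 h3 h4] [p' d' h1' h2' h3' h4'] /= in bvw dvw iv *.
subst p' d'; congr UnitTangent; exact: Prop_irrelevance.
Qed.

Lemma rotateD a b v : rotate a (rotate b v) = rotate (a + b) v.
Proof.
have [i iv] := exists_chart (base_regular (u := v)).
by apply: (@unit_tangent_eq _ _ i) => //=; rewrite rot_rot.
Qed.

Lemma dom_regular i p : dom F i p -> ~ sing F p.
Proof.
move=> ip; suff : (~` sing F) p by [].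
by rewrite -dom_cover; exists i.
Qed.

Lemma dir_unit_vec v i : dom F i (base v) -> exists t, dir v i = unit_vec t.
Proof. by move=> iv; exact/unit_vec_surj/dir_unit. Qed.

Lemma exists_tangent i p t : dom F i p ->
  exists v, base v = p /\ dir v i = unit_vec t.
Proof.
move=> ip; have [v vp] := exists_unit_tangent (dom_regular ip); subst p.
have [s vs] := dir_unit_vec ip.
by exists (rotate (t - s) v); split => //=; rewrite vs rot_unit_vec addrC subrK.
Qed.

(** [(p, t)] are the coordinates of a vector above the chart [i]; the vector is a
    default one when [p] is outside the domain of [i]. *)
Definition tangent i p t : unit_tangent F :=
  get [set v : unit_tangent F | base v = p /\ dir v i = unit_vec t].

Lemma tangentP i p t : dom F i p ->
  base (tangent i p t) = p /\ dir (tangent i p t) i = unit_vec t.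
Proof. by move=> /(exists_tangent t)[v vp]; rewrite /tangent; case: xgetP => [w _|/(_ v)]. Qed.

Lemma base_tangent i p t : dom F i p -> base (tangent i p t) = p.
Proof. by move=> /(tangentP t)[]. Qed.

Lemma dir_tangent i p t : dom F i p -> dir (tangent i p t) i = unit_vec t.
Proof. by move=> /(tangentP t)[]. Qed.

Lemma tangent_unique v i t : dom F i (base v) -> dir v i = unit_vec t ->
  v = tangent i (base v) t.
Proof.
move=> iv vt; apply: (unit_tangent_eq _ iv); first by rewrite base_tangent.
by rewrite dir_tangent.
Qed.

Lemma rotate_tangent i p t a : dom F i p ->
  rotate a (tangent i p t) = tangent i p (t + a).
Proof.
move=> ip; apply: (@unit_tangent_eq _ _ i) => /=; rewrite ?base_tangent//.
by rewrite !dir_tangent// rot_unit_vec.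
Qed.

Lemma tangentD2pi i p t : tangent i p (t + 2 * pi) = tangent i p t.
Proof.
have e : unit_vec (t + 2 * pi) = unit_vec t.
  by rewrite /unit_vec mulr_natl cosD2pi sinD2pi.
by rewrite /tangent e.
Qed.

Lemma same_fibre v w : base v = base w -> exists a, w = rotate a v.
Proof.
move=> bvw; have [i iv] := exists_chart (base_regular (u:=v)).
have iw : dom F i (base w) by rewrite -bvw.
have [s vs] := dir_unit_vec iv; have [t wt] := dir_unit_vec iw.
exists (t - s); apply: (@unit_tangent_eq _ _ i) => //=.
by rewrite vs wt rot_unit_vec addrC subrK.
Qed.

Lemma near_transition_angle i j p t : transition_angle i j p t ->
  \forall q \near p, transition_angle i j q t.
Proof. by move=> [b /near_join hb]; apply: filterS hb => q hq; exists b. Qed.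

Definition locally_parallel_at (V : R -> unit_tangent F) (s : R) :=
  forall i, dom F i (base (V s)) -> \forall s' \near s, dir (V s') i = dir (V s) i.

(** Being parallel can be tested in one chart, because the angle of a change of
    charts is locally constant. *)
Lemma locally_parallel_chart (V : R -> unit_tangent F) s i :
  {for s, continuous (@base R F \o V)} -> dom F i (base (V s)) ->
  (\forall s' \near s, dir (V s') i = dir (V s) i) -> locally_parallel_at V s.
Proof.
move=> cV iV nV j jV; have [t tij] := chart_transition iV jV.
have n1 : \forall s' \near s, transition_angle i j (base (V s')) t.
  exact: cV _ (near_transition_angle tij).
have n2 : \forall s' \near s, dom F i (base (V s')) by exact: cV _ (near_dom iV).
have n3 : \forall s' \near s, dom F j (base (V s')) by exact: cV _ (near_dom jV).
near=> s'.
rewrite (dir_transition iV jV tij).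
have -> : dir (V s') j = rot t (dir (V s') i).
  apply: dir_transition; near: s'; assumption.
congr rot; by near: s'.
Unshelve. all: by end_near. Qed.

(** A path in a leaf, parametrized by the whole line so that reparametrizing and
    gluing need no care at end points; [leafP] relates it to parallel transport
    along paths defined on the unit interval. *)
Definition horizontal_path (V : R -> unit_tangent F) :=
  continuous (@base R F \o V) /\ forall s, locally_parallel_at V s.

Lemma horizontal_path_comp V (h : R -> R) : continuous h ->
  horizontal_path V -> horizontal_path (V \o h).
Proof.
move=> ch [cV pV]; split=> [s B nB|].
  exact: ch s _ (cV _ _ nB).
by move=> s i iV; exact: ch s _ (pV _ _ iV).
Qed.

Lemma horizontal_path_rotate V a : horizontal_path V -> horizontal_path (@rotate R F a \o V).
Proof.
by move=> [cV pV]; split => // s i /pV; apply: filterS => s' /= ->.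
Qed.

Lemma horizontal_path_cst v : horizontal_path (fun=> v).
Proof.
split=> [s B /= /nbhs_singleton Bv|s i _]; last by apply: (@nearW _ (nbhs s)) => s'.
have : \forall s' \near s, B (base v) by apply: (@nearW _ (nbhs s)) => s'; exact: Bv.
by [].
Qed.

Lemma horizontal_path_cat V W c : horizontal_path V -> horizontal_path W ->
  V c = W c -> horizontal_path (fun s => if s <= c then V s else W s).
Proof.
move=> [cV pV] [cW pW] VWc; split => [s B|s i].
  rewrite /= => nB; suff : \forall s' \near s, B (base (if s' <= c then V s' else W s')) by [].
  have [sc|cs|sc] := ltgtP s c.
  - have nV : \forall s' \near s, B (base (V s')) by apply: (cV s); move: nB; rewrite ltW.
    by near=> s'; rewrite ifT; [near: s'|apply: ltW; near: s'; exact: lt_nbhsl].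
  - have nW : \forall s' \near s, B (base (W s')) by apply: (cW s); move: nB; rewrite leNgt cs.
    near=> s'; rewrite ifF; first by near: s'.
    by apply/negbTE; rewrite -ltNge; near: s'; exact: lt_nbhsr.
  - rewrite sc lexx in nB *.
    have nV : \forall s' \near c, B (base (V s')) by apply: (cV c).
    have nW : \forall s' \near c, B (base (W s')) by apply: (cW c); rewrite /= -VWc.
    by near=> s'; case: ifP => _; near: s'.
have [sc|cs|sc] := ltgtP s c; last rewrite sc; move=> iV.
- have nV := pV _ _ iV.
  near=> s'; rewrite ifT; first by near: s'.
  by apply: ltW; near: s'; exact: lt_nbhsl.
- have nW := pW _ _ iV.
  near=> s'; rewrite ifF; first by near: s'.
  by apply/negbTE; rewrite -ltNge; near: s'; exact: lt_nbhsr.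
- have nV := pV _ _ iV; have iW := iV; rewrite VWc in iW; have nW := pW _ _ iW.
  near=> s'; case: ifP => _; last rewrite VWc; by near: s'.
Unshelve. all: by end_near. Qed.

Lemma transport_horizontal_path V : horizontal_path V ->
  regular_path (@base R F \o V) /\ parallel_transport (@base R F \o V) (V 0) (V 1).
Proof.
move=> [cV pV]; split.
  by split; [exact: continuous_subspaceT|move=> s _; exact: base_regular].
exists V; split => // s _ i iV; apply: filterS (pV s i iV) => s' ->//.
Qed.

Lemma leafP v w : horizontal_leaf v w <->
  exists V, [/\ horizontal_path V, V 0 = v & V 1 = w].
Proof.
split=> [[g [[cg gS] [V [V0 V1 bV pV]]]]|[V [hV <- <-]]]; last first.
  by exists (@base R F \o V); exact: transport_horizontal_path.
exists (V \o clamp01); split.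
- have clampI (s : R) : clamp01 s \in `[0, 1] by rewrite in_itv/= clamp01_itv.
  split => [|s i].
    have -> : @base R F \o (V \o clamp01) = g \o clamp01.
      by apply/funext => s /=; rewrite (bV _ (clampI s)).
    exact: within_continuous_comp cg continuous_clamp01 clampI.
  rewrite /= (bV _ (clampI s)) => is'.
  have ns : \forall s' \near s, clamp01 s' \in `[0, 1] ->
      dir (V (clamp01 s')) i = dir (V (clamp01 s)) i.
    exact: continuous_clamp01 (pV _ (clampI s) i is').
  by apply: filterS ns => s'; apply; exact: clampI.
- by rewrite /= clamp010.
- by rewrite /= clamp011.
Qed.

Lemma leaf_refl v : horizontal_leaf v v.
Proof. by apply/leafP; exists (fun=> v); split => //; exact: horizontal_path_cst. Qed.

Lemma leaf_sym v w : horizontal_leaf v w -> horizontal_leaf w v.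
Proof.
move=> /leafP[V [hV V0 V1]]; apply/leafP.
exists (V \o (fun s => 1 - s)); split => /=; rewrite ?subr0 ?subrr//.
apply: horizontal_path_comp => // s; apply: cvgB; [exact: cvg_cst|exact: cvg_id].
Qed.

Lemma leaf_trans v1 v2 v3 : horizontal_leaf v1 v2 -> horizontal_leaf v2 v3 ->
  horizontal_leaf v1 v3.
Proof.
move=> /leafP[V [hV V0 V1]] /leafP[W [hW W0 W1]]; apply/leafP.
pose V' := V \o (fun s => 2 * s); pose W' := W \o (fun s => 2 * s - 1).
have c2 : continuous (fun s : R => 2 * s).
  by move=> s; apply: cvgM; [exact: cvg_cst|exact: cvg_id].
exists (fun s => if s <= 2^-1 then V' s else W' s); split.
- apply: horizontal_path_cat.
  + exact: horizontal_path_comp.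
  + apply: horizontal_path_comp => // s; apply: cvgB; [exact: c2|exact: cvg_cst].
  + by rewrite /V' /W' /= divff// subrr V1 W0.
- by rewrite ifT ?invr_ge0// /V' /= mulr0.
- rewrite ifF; last by apply/negbTE; rewrite -ltNge invf_lt1// ltr1n.
  by rewrite /W'/= -W1; congr W; ring.
Qed.

(** Parallel transport commutes with the rotations of the fibres. *)
Lemma leaf_rotate v w a : horizontal_leaf v w -> horizontal_leaf (rotate a v) (rotate a w).
Proof.
move=> /leafP[V [hV <- <-]]; apply/leafP; exists (@rotate R F a \o V); split => //.
exact: horizontal_path_rotate.
Qed.

End UnitTangentVectors.

Section LocalTriviality.
Context {R : realType} (F : flatSurface R).
Implicit Types (v w : unit_tangent F) (i j : chart_index F) (p q : F) (a b t : R).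

Lemma open_near (T : topologicalType) (U : set T) x : open U -> U x -> nbhs x U.
Proof. by move=> oU Ux; apply: open_nbhs_nbhs. Qed.

(** Charts are open and injective, so they have continuous local inverses, along
    which paths of the plane can be lifted. *)
Lemma chart_lift i (z : R -> R * R) : continuous z ->
  (forall s, (chart F i @` dom F i) (z s)) ->
  exists g : R -> F, [/\ continuous g, forall s, dom F i (g s) &
    forall s, chart F i (g s) = z s].
Proof.
move=> cz zi.
have /choice[g gP] : forall s, exists q, dom F i q /\ chart F i q = z s.
  by move=> s; have [q iq <-] := zi s; exists q.
exists g; split => [s B|s|s]; [|exact: (gP s).1|exact: (gP s).2].
rewrite nbhsE => -[U [oU Us] UB].
have oC : open (chart F i @` (U `&` dom F i)).
  by apply: chart_open; [apply: openI => //; exact: dom_open|exact: subIsetr].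
have Cs : (chart F i @` (U `&` dom F i)) (z s).
  by exists (g s); [split => //; exact: (gP s).1|exact: (gP s).2].
have ns : \forall s' \near s, (chart F i @` (U `&` dom F i)) (z s').
  exact: cz s _ (open_near oC Cs).
suff : \forall s' \near s, B (g s') by [].
apply: filterS ns => s' [q [Uq iq] qz]; apply: UB.
have [ig gz] := gP s'.
by rewrite -(chart_inj iq ig) // qz gz.
Qed.

Lemma horizontal_path_tangent i (g : R -> F) t : continuous g ->
  (forall s, dom F i (g s)) -> horizontal_path (fun s => tangent i (g s) t).
Proof.
move=> cg ig.
have cb : continuous (@base R F \o (fun s => tangent i (g s) t)).
  have -> : @base R F \o (fun s => tangent i (g s) t) = g.
    by apply/funext => s /=; rewrite base_tangent.
  by [].
split=> // s; apply: (@locally_parallel_chart _ _ _ _ i).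
- exact: cb.
- by rewrite base_tangent.
- by apply: (@nearW _ (nbhs s)) => s'; rewrite !dir_tangent.
Qed.

(** [U] is the preimage of a ball of the plane around the image of [p]; straight
    segments in that ball, lifted to the surface, carry vectors of constant angle
    to one another. *)
Lemma flat_box i p : dom F i p -> exists U : set F, [/\ open U, U p, U `<=` dom F i &
  forall q t, U q -> horizontal_leaf (tangent i p t) (tangent i q t)].
Proof.
move=> ip.
have oD : open (chart F i @` dom F i).
  by apply: chart_open => //; exact: dom_open.
have : nbhs (chart F i p) (chart F i @` dom F i) by apply: open_near => //; exists p.
move=> /nbhs_ballP[e /= e0 be].
(* taking points with a neighbourhood in the preimage makes the box open *)
exists ([set q | nbhs q [set q | dom F i q /\ ball (chart F i p) e (chart F i q)]]).
split.
- rewrite openE => q /= nq.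
  by have := @nbhs_interior _ q _ nq.
- apply: filterI; first exact: near_dom.
  exact: chart_continuous ip _ (nbhsx_ballx _ _ e0).
- by move=> q /nbhs_singleton[].
move=> q t /nbhs_singleton[iq pq].
pose d := chart F i q - chart F i p.
pose z s := chart F i p + (clamp01 s * d.1, clamp01 s * d.2).
have c01 (s : R) : `|clamp01 s| <= 1.
  by have /andP[s0 s1] := clamp01_itv s; rewrite ger0_norm.
have cz : continuous z.
  move=> s; apply: cvgD; first exact: cvg_cst.
  have cl (c : R) : continuous (fun s' => clamp01 s' * c).
    by move=> s'; apply: cvgM; [exact: continuous_clamp01|exact: cvg_cst].
  exact: (continuous_pair (cl d.1) (cl d.2)).
have [|g [cg ig gz]] := chart_lift cz (i := i).
  move=> s; apply: be; move: pq; rewrite /z => -[pq1 pq2].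
  by split; rewrite /ball/= opprD addrA subrr add0r normrN normrM;
    [move: pq1|move: pq2]; rewrite /ball/= distrC; apply: le_lt_trans;
    rewrite ler_piMl.
have /transport_horizontal_path hp := horizontal_path_tangent t cg ig.
have gE s q' : dom F i q' -> z s = chart F i q' -> g s = q'.
  by move=> iq' zq'; apply: (chart_inj (ig s) iq'); rewrite gz.
rewrite -(gE 0 p ip); last first.
  rewrite /z clamp010 !mul0r.
  exact: addr0.
rewrite -(gE 1 q iq); last first.
  by rewrite /z clamp011 !mul1r /d -surjective_pairing addrC subrK.
by eexists; exact: hp.
Qed.

End LocalTriviality.

(** * The parallel frame around a cone point *)

Section ConeFrame.
Context {R : realType} (F : flatSurface R).
Context (p : F) (angle r0 : R) (c : R * R -> F).
Context (coneP : cone_coordinates (sing F) (dom F) (chart F) p angle r0 c).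
Implicit Types (v w : unit_tangent F) (i j : chart_index F) (q : F) (a r t : R) (b z : R * R).

(** The domain of the polar coordinates around a cone point, without the cone
    point; the second coordinate ranges over the whole line. *)
Definition annulus : set (R * R) := [set z | 0 < z.1 < r0].

Lemma near_annulus z : annulus z -> \forall z' \near z, annulus z'.
Proof.
case: z => r t; rewrite /annulus/= => /andP[r1 r2].
have n1 : \forall z' \near ((r, t) : R * R), 0 < z'.1.
  by exact: (@cvg_fst _ _ (nbhs r) (nbhs t) _ _ (lt_nbhsr r1)).
have n2 : \forall z' \near ((r, t) : R * R), z'.1 < r0.
  by exact: (@cvg_fst _ _ (nbhs r) (nbhs t) _ _ (lt_nbhsl r2)).
by near=> z'; apply/andP; split; near: z'.
Unshelve. all: by end_near. Qed.

Lemma cone_continuous_at z : annulus z -> {for z, continuous c}.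
Proof.
move=> Az B nB; have [_ cc _ _ _] := coneP.
have Az' : 0 <= z.1 < r0 by case/andP: Az => /ltW -> ->.
have n1 := within_continuous_near cc Az' nB.
suff : \forall z' \near z, B (c z') by [].
have n2 := near_annulus Az.
near=> z'; have : annulus z' by near: z'.
move=> /andP[/ltW h1 h2].
have h : 0 <= z'.1 < r0 by rewrite h1 h2.
by move: h; near: z'.
Unshelve. all: by end_near. Qed.

Lemma cone_regular z : annulus z -> ~ sing F (c z).
Proof. by case: z => r t; have [_ _ cS _ _] := coneP; exact: cS. Qed.

(** Near [z], the chart [i] is the developing map of the cone followed by the
    rotation of angle [a] and a translation. *)
Definition chart_rotation i z a :=
  exists b, \forall z' \near z, chart F i (c z') = rot a (from_polar z') + b.

Lemma exists_chart_rotation i z : annulus z -> dom F i (c z) ->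
  exists a, chart_rotation i z a.
Proof. by case: z => r t rz iz; have [_ _ _ _ [+ _]] := coneP; exact. Qed.

(** The vector whose image in the developing map is the first basis vector; by
    [polar_chart_unique] the angles read in the various charts are consistent. *)
Lemma exists_frame z : annulus z -> exists v, base v = c z /\
  forall i a, dom F i (c z) -> chart_rotation i z a -> dir v i = unit_vec a.
Proof.
move=> Az; have [i iz] := exists_chart (cone_regular Az).
have [a [b ab]] := exists_chart_rotation Az iz.
exists (tangent i (c z) a); split; first by rewrite base_tangent.
move=> j a' jz [b' ab'].
have [t tij] := chart_transition iz jz.
rewrite (dir_transition (i := i) (t := t)) ?base_tangent// dir_tangent// rot_unit_vec.
have [d hd] := tij.
have nd : \forall z' \near z, chart F j (c z') = rot t (chart F i (c z')) + d.
  exact: cone_continuous_at Az _ hd.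
case: z => r s in Az iz ab jz ab' tij hd nd *.
apply: (@polar_chart_unique _ r s _ _ (rot t b + d) b').
near=> z'.
have <- : chart F j (c z') = rot a' (from_polar z') + b' by near: z'.
rewrite (near nd z')// (near ab z')// rotD rot_rot addrA [t + a]addrC//.
Unshelve. all: by end_near. Qed.

Definition frame z : unit_tangent F :=
  get [set v : unit_tangent F | base v = c z /\
    forall i a, dom F i (c z) -> chart_rotation i z a -> dir v i = unit_vec a].

Lemma frameP z : annulus z -> base (frame z) = c z /\
  forall i a, dom F i (c z) -> chart_rotation i z a -> dir (frame z) i = unit_vec a.
Proof. by move=> /exists_frame[v vP]; rewrite /frame; case: xgetP => [w _|/(_ v)]. Qed.

Lemma horizontal_path_frame (g : R -> R * R) : continuous g ->
  (forall s, annulus (g s)) -> horizontal_path (frame \o g).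
Proof.
move=> cg Ag.
have cb : continuous (@base R F \o (frame \o g)).
  have -> : @base R F \o (frame \o g) = c \o g.
    by apply/funext => s /=; rewrite (frameP (Ag s)).1.
  by move=> s B nB; exact: cg s _ (cone_continuous_at (Ag s) nB).
split=> // s i; rewrite /= (frameP (Ag s)).1 => is'.
have [a [b ab]] := exists_chart_rotation (Ag s) is'.
have n1 : \forall z \near g s, chart_rotation i z a.
  by move/near_join : ab; apply: filterS => z hz; exists b.
have n2 : \forall z \near g s, dom F i (c z).
  exact: cone_continuous_at (Ag s) _ (near_dom is').
have n3 : \forall s' \near s, chart_rotation i (g s') a by exact: cg s _ n1.
have n4 : \forall s' \near s, dom F i (c (g s')) by exact: cg s _ n2.
near=> s'.
rewrite ((frameP (Ag s)).2 i a)//; last by exists b.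
by apply: (frameP (Ag s')).2; near: s'.
Unshelve. all: by end_near. Qed.

(** The points [(r, t)] and [(r, t + angle)] are the same point of the cone, but
    the developing map has turned by [angle] in between. *)
Lemma frame_turn r t : annulus (r, t) ->
  frame (r, t + angle) = rotate (- angle) (frame (r, t)).
Proof.
move=> A1; have A2 : annulus (r, t + angle) by [].
have ct : c (r, t + angle) = c (r, t).
  have [_ _ _ cinj _] := coneP.
  by apply/esym/(cinj r t r (t + angle)) => //; split=> //; exists 1; rewrite mul1r.
have [i iz] := exists_chart (cone_regular A1).
have iz2 : dom F i (c (r, t + angle)) by rewrite ct.
have [b1 f1] := frameP A1; have [b2 f2] := frameP A2.
have [a [b ab]] := exists_chart_rotation A1 iz.
apply: (@unit_tangent_eq _ _ _ _ i) => /=.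
- by rewrite b1 b2 ct.
- by rewrite b2 ct.
rewrite (f1 i a)//; last by exists b.
rewrite rot_unit_vec; apply: f2 => //; exists b.
(* near (r, t + angle), the chart is read off its expression near (r, t) *)
pose sh (z : R * R) : R * R := (z.1, z.2 - angle).
have csh : sh z @[z --> ((r, t + angle) : R * R)] --> ((r, t) : R * R).
  apply: (cvg_pair (FG := nbhs_filter r) (FH := nbhs_filter t)); first exact: cvg_fst.
  have -> : nbhs t = nbhs (t + angle - angle) by rewrite addrK.
  by apply: cvgB; [exact: cvg_snd|exact: cvg_cst].
have n1 : \forall z \near ((r, t + angle) : R * R),
    chart F i (c (sh z)) = rot a (from_polar (sh z)) + b.
  exact: csh _ ab.
have n2 := near_annulus A2.
near=> z.
have Az : annulus z by near: z.
have e1 := near n1 z.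
have -> : c z = c (sh z).
  case: (z) Az => r' t' Ar; have [_ _ _ cinj _] := coneP.
  rewrite /sh/=; apply/esym/(cinj r' (t' - angle) r' t') => //; split => //.
  by exists 1; rewrite mul1r subrK.
rewrite e1//; congr (_ + _); rewrite -rot_rot; congr rot.
by case: (z) => r' t'; rewrite -from_polar_rot.
Unshelve. all: by end_near. Qed.

Lemma segment_between (l u x y s : R) : l < x < u -> l < y < u -> 0 <= s <= 1 ->
  l < x + s * (y - x) < u.
Proof.
move=> /andP[lx xu] /andP[ly yu] /andP[s0 s1].
have s1' : 0 <= 1 - s by rewrite subr_ge0.
have [xy|/ltW xy] := leP x y; rewrite -subr_ge0 in xy;
  have h1 := mulr_ge0 s0 xy; have h2 := mulr_ge0 s1' xy; apply/andP; split; lra.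
Qed.

(** The segment joining [z] and [z'] in polar coordinates avoids the cone point,
    and the frame is parallel along it. *)
Lemma leaf_frame z z' : annulus z -> annulus z' -> horizontal_leaf (frame z) (frame z').
Proof.
move=> /andP[z1 z2] /andP[z1' z2'].
pose g s := (z.1 + clamp01 s * (z'.1 - z.1), z.2 + clamp01 s * (z'.2 - z.2)).
apply/leafP; exists (frame \o g); split.
- apply: horizontal_path_frame.
    have cl (d e : R) : continuous (fun s => d + clamp01 s * e).
      move=> s; apply: cvgD; first exact: cvg_cst.
      by apply: cvgM; [exact: continuous_clamp01|exact: cvg_cst].
    exact: continuous_pair.
  by move=> s; have s01 := clamp01_itv s; apply: segment_between; rewrite ?z1 ?z1'.
- by rewrite /g/= clamp010 !mul0r !addr0 -surjective_pairing.
- by rewrite /g/= clamp011 !mul1r ![_ + (_ - _)]addrC !subrK -surjective_pairing.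
Qed.

End ConeFrame.

Section ConeHolonomy.
Context {R : realType} (F : flatSurface R).

Lemma rationalN (x : R) : rational (- x) -> rational x.
Proof. by move=> [q _ qx]; exists (- q) => //; rewrite rmorphN/= qx opprK. Qed.

(** Parallel transport along a circle around the cone point is the rotation of
    minus the cone angle, by [frame_turn]. *)
Lemma non_rational_cone (p : F) : sing F p -> irrational (cone_angle p / (2 * pi)) ->
  non_rational_holonomy F.
Proof.
move=> Sp irr; have [r0 [c [r00 coneP]]] := sing_cone Sp.
pose r := r0 / 2.
have Ar t : annulus r0 (r, t).
  by rewrite /annulus/= /r divr_gt0//= ltr_pdivrMr// ltr_pMr// ltr1n.
pose V s := frame c (r, s * cone_angle p).
have hV : horizontal_path V.
  apply: (horizontal_path_frame coneP (g := fun s => (r, s * cone_angle p))) => //.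
  apply: continuous_pair; first exact: cst_continuous.
  by move=> s; apply: cvgM; [exact: cvg_id|exact: cvg_cst].
have V1 : V 1 = rotate (- cone_angle p) (V 0).
  by rewrite /V mul1r mul0r -(frame_turn coneP)// add0r.
exists (@base _ F \o V), (- cone_angle p); split.
- by have [] := transport_horizontal_path hV.
- by rewrite /= V1.
- move=> v /esym/same_fibre[b ->].
  rewrite rotateD addrC -rotateD -V1.
  by have [_] := transport_horizontal_path (horizontal_path_rotate b hV).
- by move=> rt; apply: irr; apply: rationalN; rewrite -mulNr.
Qed.

End ConeHolonomy.

(** * Every leaf meets every fibre *)

Section LeavesMeetFibres.
Context {R : realType} (F : flatSurface R).
Implicit Types (v w : unit_tangent F) (p q : F).

Definition leaf_over v p := exists w, base w = p /\ horizontal_leaf v w.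

Lemma leaf_over_flat_box v p q w w' : base w = p -> base w' = q -> horizontal_leaf w w' ->
  leaf_over v p -> leaf_over v q.
Proof.
move=> wp wq ww' [w1 [w1p vw1]].
have [a aw] : exists a, w1 = rotate a w by apply: same_fibre; rewrite wp w1p.
exists (rotate a w'); split => //=; apply: leaf_trans vw1 _.
by rewrite aw; exact: leaf_rotate.
Qed.

(** Near a regular point this comes from [flat_box].  Near a cone point, the
    punctured neighbourhood is covered by the parallel frame, all of whose values
    lie in the same leaf. *)
Lemma leaf_over_locally_all_or_none v p : exists U : set F, [/\ nbhs p U,
  forall q, U q -> q <> p -> ~ sing F q &
  forall q q', U q -> U q' -> ~ sing F q -> ~ sing F q' -> leaf_over v q -> leaf_over v q'].
Proof.
have [Sp|Sp] := pselect (sing F p).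
  have [r0 [c [r00 coneP]]] := sing_cone Sp.
  have [c0 _ _ _ [_ cnbhs]] := coneP.
  have hr : r0 / 2 < r0 by rewrite ltr_pdivrMr// ltr_pMr// ltr1n.
  have Ac q : (c @` [set z | 0 <= z.1 < r0 / 2]) q ->
      q = p \/ exists2 z, annulus r0 z & c z = q.
    move=> [[r t] /= /andP[]]; rewrite le_eqVlt => /predU1P[<- _ <-|r1 r2 <-].
      by left.
    by right; exists (r, t) => //; apply/andP; split => //; exact: lt_trans hr.
  exists (c @` [set z | 0 <= z.1 < r0 / 2]); split.
  - by apply: cnbhs; rewrite divr_gt0.
  - move=> q /Ac[->//|[z Az <-] _]; exact: cone_regular coneP _ Az.
  - move=> q q' /Ac[->//|[z Az <-]] /Ac[->//|[z' Az' <-]] _ _.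
    apply: (@leaf_over_flat_box _ _ _ (frame c z) (frame c z')).
    + exact: (frameP coneP Az).1.
    + exact: (frameP coneP Az').1.
    + by have := leaf_frame coneP Az Az'.
have [i ip] := exists_chart Sp; have [U [oU Up Ui hU]] := flat_box ip.
exists U; split.
- exact: open_near.
- by move=> q /Ui /dom_regular.
- move=> q q' Uq Uq' _ _; apply: (@leaf_over_flat_box _ _ _ (tangent i q 0) (tangent i q' 0)).
  + by rewrite base_tangent//; exact: Ui.
  + by rewrite base_tangent//; exact: Ui.
  + by apply: leaf_trans (leaf_sym (hU q 0 Uq)) _; exact: hU.
Qed.

(** A connectedness argument on the whole surface.  The set [A] makes sense at
    the cone points as well, and it is open and closed by
    [leaf_over_locally_all_or_none]; in this way the connectedness of the surface
    yields that of the complement of the cone points. *)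
Lemma leaf_over_regular v p : ~ sing F p -> leaf_over v p.
Proof.
pose A : set F := [set q | \forall q' \near q, ~ sing F q' -> leaf_over v q'].
move=> Sp; suff AT : A = setT.
  have /nbhs_singleton : A p by rewrite AT.
  exact.
apply: (surface_connected (f := F)).
- exists (base v); have [U [Uv _ UT]] := leaf_over_locally_all_or_none v (base v).
  apply: filterS (Uv) => q Uq Sq; apply: (UT (base v)) => //.
  + exact: nbhs_singleton Uv.
  + exact: base_regular.
  + by exists v; split => //; exact: leaf_refl.
- exists A; last by rewrite setTI.
  by rewrite openE => q /near_join.
- exists A; last by rewrite setTI.
  rewrite -[A]setCK; apply: open_closedC; rewrite openE => q nAq.
  have [U [Uq Ureg UT]] := leaf_over_locally_all_or_none v q.
  apply: filterS (Uq) => q' Uq' Aq'.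
  have [qq'|qq'] := pselect (q' = q); first by apply: nAq; rewrite -qq'.
  have Sq' := Ureg _ Uq' qq'.
  apply: nAq; apply: filterS (Uq) => q'' Uq'' Sq''.
  by apply: (UT q') => //; exact: (nbhs_singleton Aq').
Qed.

End LeavesMeetFibres.

(** * Null sets of the volume in local coordinates *)

Section MeasurePreliminaries.
Context {R : realType}.
Local Notation mu := (@lebesgue_measure R).
Local Notation mu2 := (@lebesgue_measure R \x @lebesgue_measure R)%E.

(** Cover the open set by the countably many balls with rational centre and
    radius the inverse of an integer that it contains: such a ball is a product of
    intervals. *)
Lemma open_measurable3 (U : set (R * R * R)) : open U -> measurable U.
Proof.
move=> oU.
pose pt (q : rat * rat * rat) : R * R * R := (ratr q.1.1, ratr q.1.2, ratr q.2).
pose I := [set i : rat * rat * rat * nat | ball (pt i.1) i.2.+1%:R^-1 `<=` U].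
pose box (i : rat * rat * rat * nat) := if i \in I then ball (pt i.1) (i.2.+1%:R^-1) else set0.
have -> : U = \bigcup_i box i.
  apply/seteqP; split => [z Uz|z [i _]]; last first.
    by rewrite /box; case: ifPn => // /set_mem; exact.
  have /nbhs_ballP[e /= e0 eU] : nbhs z U by apply: open_nbhs_nbhs.
  have [n ne] : exists n, n.+1%:R^-1 < e / 2.
    have e20 : 0 < e / 2 by rewrite divr_gt0.
    have [n _ /(_ n (leqnn n)) nP] := near_infty_natSinv_lt (PosNum e20).
    by exists n.
  set d : R := n.+1%:R^-1 in ne *.
  have d0 : 0 < d by rewrite invr_gt0.
  have rd (x : R) : exists q : rat, ball x d (ratr q).
    have [|q] := @rat_in_itvoo R (x - d) (x + d); first by lra.
    rewrite in_itv/= => /andP[q1 q2]; exists q; apply/ltr_normlP; split; lra.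
  case: z Uz eU => [[x y] t] Uz eU.
  have [q1 xq] := rd x; have [q2 yq] := rd y; have [q3 tq] := rd t.
  exists (q1, q2, q3, n) => //.
  have inI : I (q1, q2, q3, n).
    move=> [[x' y'] t'] [[/= h1 h2] h3]; apply: eU.
    have e2 : d + d <= e by lra.
    split; [split|] => /=; apply: (le_ball e2).
    - exact: ball_triangle xq h1.
    - exact: ball_triangle yq h2.
    - exact: ball_triangle tq h3.
  rewrite /box mem_set//=.
  by split; [split|]; exact: ball_sym.
apply: countable_bigcupT_measurable => [|i]; first exact: countableP.
rewrite /box; case: ifP => // _.
have -> : ball (pt i.1) i.2.+1%:R^-1 =
    (ball (pt i.1).1.1 i.2.+1%:R^-1 `*` ball (pt i.1).1.2 i.2.+1%:R^-1) `*`
    ball (pt i.1).2 i.2.+1%:R^-1 by [].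
by apply: measurableX; [apply: measurableX|]; exact: measurable_ball.
Qed.

Lemma open_measure2_gt0 (U : set (R * R)) (N : set (R * R)) : open U -> U !=set0 ->
  measurable N -> mu2 N = 0%E -> exists2 z, U z & ~ N z.
Proof.
move=> oU [z Uz] mN N0; apply: contrapT => noz.
have UN : U `<=` N by move=> z' Uz'; apply: contrapT => nN; apply: noz; exists z'.
have /nbhs_ballP[e /= e0 eU] : nbhs z U by apply: open_nbhs_nbhs.
have mB (x : R) : measurable (ball x e) by exact: measurable_ball.
have : (mu2 (ball z.1 e `*` ball z.2 e) <= mu2 N)%E.
  apply: le_measure; rewrite ?inE//; first exact: (measurableX (mB _) (mB _)).
  by move=> [x y] [h1 h2]; apply: UN; apply: eU.
have -> : mu2 (ball z.1 e `*` ball z.2 e) = (e *+ 2 * (e *+ 2))%:E.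
  rewrite product_measure1E; [|exact: mB|exact: mB].
  by rewrite EFinM; congr (_ * _)%E; apply: lebesgue_measure_ball; exact: ltW.
rewrite N0 lee_fin.
by apply/negP; rewrite -ltNge mulr_gt0// pmulrn_lgt0.
Qed.

(** The translates by the multiples of [b] of an interval of length [b] are
    countably many and cover the line. *)
Lemma ae_periodic (P : R -> Prop) b : 0 < b -> (forall t, P (t + b) <-> P t) ->
  {ae mu, forall t, 0 <= t < b -> P t} -> {ae mu, forall t, P t}.
Proof.
move=> b0 Pb Pae.
have : {ae mu, forall t, forall n, if unpickle n is Some k then
    0 <= t + k%:~R * b < b -> P (t + k%:~R * b) else True}.
  apply: ae_foralln => n; case: (unpickle n) => [k|]; last exact: aeW.
  exact: (@ae_shift R (k%:~R * b) (fun t => 0 <= t < b -> P t) Pae).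
apply: ae_imp => t tP.
have perk (k : int) : forall s, P (s + k%:~R * b) <-> P s.
  pose G : set R := [set h | forall s, P (s + h) <-> P s].
  apply: (@subgroupMz R G b k) => //.
    by move=> s; rewrite addr0.
  move=> x y Gx Gy s; rewrite -(Gy (s + (x - y))) -addrA subrK; exact: Gx.
have /andP[l u] := floor_itv (t / b).
rewrite ler_pdivlMr// in l; rewrite ltr_pdivrMr// intrD mulrDl mul1r in u.
have := tP (pickle (- Num.floor (t / b))); rewrite pickleK perk; apply.
by rewrite mulrNz mulNr subr_ge0 l/= ltrBlDr addrC.
Qed.

End MeasurePreliminaries.

Section ProductCoordinates.
Context {R : realType} (F : flatSurface R).
Local Notation mu := (@lebesgue_measure R).
Local Notation mu2 := (@lebesgue_measure R \x @lebesgue_measure R)%E.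
Implicit Types (i : chart_index F) (p q : F) (A : set (tangent_borel F)).

(** [in_coordinates i A] is the preimage of [A] under [tangent i], the chart being
    used to identify its domain with an open set of the plane. *)
Lemma in_coordinatesE i A q t : dom F i q ->
  in_coordinates i A (chart F i q, t) <-> A (tangent i q t).
Proof.
move=> iq; split=> [[v [Av iv /= cv dv]]|Atan].
  by rewrite -(chart_inj iv iq cv) -tangent_unique.
by exists (tangent i q t); rewrite base_tangent// dir_tangent.
Qed.

Lemma in_coordinates_dom i A z : in_coordinates i A z ->
  exists2 q, dom F i q & chart F i q = z.1.
Proof. by move=> [v [_ iv <- _]]; exists (base v). Qed.

Lemma xsection_in_coordinates i A q : dom F i q ->
  xsection (in_coordinates i A) (chart F i q) = [set t | A (tangent i q t)].
Proof.
move=> iq; apply/seteqP; split=> t; rewrite /xsection/= inE.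
  by move/(in_coordinatesE A t iq).
by move=> At; apply/(in_coordinatesE A t iq).
Qed.

Lemma in_coordinates_over i (U : set F) :
  in_coordinates i [set v | U (base v)] = (chart F i @` (U `&` dom F i)) `*` setT.
Proof.
apply/seteqP; split=> [[z t] [v [/= Uv iv cv dv]]|[z t] [[q [Uq iq] /= <-] _]].
  by split => //; exists (base v).
by apply/in_coordinatesE => //=; rewrite base_tangent.
Qed.

Lemma open_chart_image i (U : set F) : open U -> open (chart F i @` (U `&` dom F i)).
Proof.
by move=> oU; apply: chart_open; [apply: openI => //; exact: dom_open|exact: subIsetr].
Qed.

Lemma measurable_over (U : set F) : open U ->
  measurable ([set v | U (base v)] : set (tangent_borel F)).
Proof.
move=> oU; apply: sub_sigma_algebra => i.
rewrite in_coordinates_over setXT.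
by apply: open_comp => [z _|]; [exact: cvg_fst|exact: open_chart_image].
Qed.

Lemma measurable_in_coordinates i A : measurable A -> measurable (in_coordinates i A).
Proof.
have mD : measurable (in_coordinates i ([set: tangent_borel F])).
  have -> : [set: tangent_borel F] = [set v | [set: F] (base v)].
    by apply/seteqP; split.
  apply: open_measurable3; rewrite in_coordinates_over setXT.
  by apply: open_comp => [z _|]; [exact: cvg_fst|apply: open_chart_image; exact: openT].
suff : <<s @tangent_open R F >> `<=` [set B | measurable (in_coordinates i B)].
  exact.
apply: smallest_sub => [|B oB]; last by apply: open_measurable3; exact: oB.
split => [|B mB|B mB] /=.
- have -> : in_coordinates i (set0 : set (unit_tangent F)) = set0.
    by apply/seteqP; split => // z [v []].
  exact: measurable0.
- have -> : in_coordinates i (setT `\` B) = in_coordinates i setT `\` in_coordinates i B.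
    apply/seteqP; split => [[z t]|[z t] [iT niB]].
      move=> izt; have [q iq /= qz] := in_coordinates_dom izt; subst z.
      move/(in_coordinatesE _ _ iq) : izt => [_ nB].
      by split; [exact/(in_coordinatesE _ _ iq)|move=> /(in_coordinatesE _ _ iq)].
    have [q iq /= qz] := in_coordinates_dom iT; subst z.
    apply/(in_coordinatesE _ _ iq); split => // Bt; apply: niB.
    exact/(in_coordinatesE _ _ iq).
  exact: measurableD.
- have -> : in_coordinates i (\bigcup_k B k) = \bigcup_k in_coordinates i (B k).
    apply/seteqP; split => [z [v [[k _ Bv] iv cv dv]]|z [k _ [v [Bv iv cv dv]]]].
      by exists k => //; exists v.
    by exists v; split => //; exists k.
  exact: bigcupT_measurable.
Qed.

Lemma measurable_tangent_preimage i q A : dom F i q -> measurable A ->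
  measurable [set t : R | A (tangent i q t)].
Proof.
move=> iq mA; rewrite -xsection_in_coordinates//; apply: measurable_xsection.
exact: measurable_in_coordinates.
Qed.

Lemma measurable_half_open_fibre i q A : dom F i q -> measurable A ->
  measurable [set t : R | A (tangent i q t) /\ 0 <= t < 2 * pi].
Proof.
move=> iq mA; have -> : [set t : R | A (tangent i q t) /\ 0 <= t < 2 * pi] =
    [set t | A (tangent i q t)] `&` `[0, 2 * pi[.
  by apply/seteqP; split => t /=; rewrite in_itv.
apply: measurableI; last exact: measurable_itv.
exact: measurable_tangent_preimage.
Qed.

(** The volume counts each angle once, whereas the periodicity argument is on the
    whole line; the two notions of null set agree since [tangent i q] is
    periodic. *)
Lemma null_fibre i q A : dom F i q -> measurable A ->
  mu [set t | A (tangent i q t) /\ 0 <= t < 2 * pi] = 0%E <->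
  {ae mu, forall t, ~ A (tangent i q t)}.
Proof.
move=> iq mA; split=> [A0|[N [mN N0 AN]]].
  apply: (@ae_periodic R _ (2 * pi)).
  - by rewrite mulr_gt0// pi_gt0.
  - by move=> t; rewrite tangentD2pi.
  exists [set t | A (tangent i q t) /\ 0 <= t < 2 * pi]; split => //.
    exact: measurable_half_open_fibre.
  by move=> t /= /not_implyP[t02 /contrapT].
apply: (subset_measure0 (B := N)) => //.
  exact: measurable_half_open_fibre.
by move=> t [At _]; apply: AN => /(_ At).
Qed.

Context (vol : {measure set (tangent_borel F) -> \bar R}) (volP : is_volume vol).

(** Tonelli: an integral of a nonnegative function vanishes if and only if the
    function vanishes almost everywhere. *)
Lemma volume_null i A : measurable A -> A `<=` [set v | dom F i (base v)] ->
  vol A = 0%E <->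
  {ae mu2, forall z, forall q, dom F i q -> chart F i q = z ->
     {ae mu, forall t, ~ A (tangent i q t)}}.
Proof.
move=> mA Ai; rewrite (volP mA Ai).
set W := _ `&` _.
have mW : measurable W.
  apply: measurableI; first exact: measurable_in_coordinates.
  have -> : [set z : R * R * R | 0 <= z.2 < 2 * pi] = setT `*` `[0, 2 * pi[.
    by apply/seteqP; split => [z|z []]; rewrite /= in_itv.
  by apply: measurableX => //; exact: measurable_itv.
have WE q : dom F i q -> xsection W (chart F i q) =
    [set t | A (tangent i q t) /\ 0 <= t < 2 * pi].
  move=> iq; apply/seteqP; split=> t; rewrite /xsection/= inE => -[].
    by move/(in_coordinatesE _ _ iq).
  by move=> At t02; split => //; exact/(in_coordinatesE _ _ iq).
have W0 z : ~ (chart F i @` dom F i) z -> xsection W z = set0.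
  move=> nz; apply/seteqP; split=> // t.
  rewrite /xsection/= inE => -[/in_coordinates_dom[q iq qz] _].
  by apply: nz; exists q.
have mf := measurable_fun_xsection mu mW.
have -> : ((mu2 \x mu) W = \int[mu2]_z `|(mu \o xsection W) z|)%E.
  by apply: eq_integral => z _; rewrite gee0_abs.
rewrite (ae_eq_integral_abs mu2 measurableT mf).
split; apply: ae_imp => z.
- move=> /(_ Logic.I) /= z0 q iq qz; subst z.
  by apply/null_fibre => //; rewrite -WE.
- move=> Az _ /=.
  have [[q iq qz]|nz] := pselect ((chart F i @` dom F i) z); last by rewrite W0// measure0.
  by have := Az _ iq qz; rewrite -qz WE// => /null_fibre; apply.
Qed.

End ProductCoordinates.

(** * Ergodicity *)

Section Ergodicity.
Context {R : realType} (F : flatSurface R).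
Context (vol : {measure set (tangent_borel F) -> \bar R}) (volP : is_volume vol).
Local Notation mu := (@lebesgue_measure R).
Local Notation mu2 := (@lebesgue_measure R \x @lebesgue_measure R)%E.
Implicit Types (i : chart_index F) (p q : F).

Definition leaf_invariant (f : unit_tangent F -> R) :=
  forall v w, horizontal_leaf v w -> f w = f v.

(** The leaves on which the given representative varies fill a null set, so that
    replacing it by 0 there changes it only on a null set. *)
Lemma leaf_invariant_representative (u : tangent_borel F -> R) :
  constant_on_ae_leaf vol u ->
  exists2 f, leaf_invariant f & {ae vol, forall v, u v = f v}.
Proof.
move=> [u' uu' u'leaf].
pose good v := forall w, horizontal_leaf v w -> u' w = u' v.
have good_leaf v w : horizontal_leaf v w -> good v -> good w.
  move=> vw gv x wx; rewrite (gv w vw); apply: gv; exact: leaf_trans wx.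
exists (fun v => if `[< good v >] then u' v else 0); last first.
  by apply: ae_imp2 uu' u'leaf => v -> gv; rewrite asboolT.
move=> v w vw; have [gv|ngv] := pselect (good v).
  by rewrite !asboolT//; [exact: gv|exact: good_leaf gv].
by rewrite !asboolF// => gw; apply: ngv; apply: good_leaf gw; exact: leaf_sym.
Qed.

Section AlmostInvariantFunction.
Context (u : tangent_borel F -> R) (f : unit_tangent F -> R)
  (mu_u : measurable_fun [set: tangent_borel F] u) (f_leaf : leaf_invariant f)
  (u_f : {ae vol, forall v, u v = f v}).

Lemma ae_fibre_in_box i p (U : set F) : open U -> U `<=` dom F i ->
  (forall q t, U q -> horizontal_leaf (tangent i p t) (tangent i q t)) ->
  {ae mu2, forall z, forall q, U q -> chart F i q = z ->
     {ae mu, forall t, u (tangent i q t) = f (tangent i p t)}}.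
Proof.
move=> oU Ui pU; have [N [mN N0 ufN]] := u_f.
pose A : set (tangent_borel F) := N `&` [set v | U (base v)].
have mA : measurable A by apply: measurableI => //; exact: measurable_over.
have A0 : vol A = 0%E.
  by apply: (subset_measure0 (B := N)) => //; exact: subIsetl.
have Ai : A `<=` [set v | dom F i (base v)] by move=> v [_ /Ui].
move/(volume_null volP mA Ai) : A0; apply: ae_imp => z Az q Uq qz.
apply: ae_imp (Az q (Ui _ Uq) qz) => t nAt.
rewrite -(f_leaf (pU q t Uq)); apply: contrapT => nuf; apply: nAt; split.
  by apply: ufN.
by rewrite /= base_tangent//; exact: Ui.
Qed.

(** By Fubini, almost every [q] in a flat box around [p] has a fibre on which
    [u] and [f] agree almost everywhere; [f] takes the same values on the fibres
    over [p] and [q], and [u] is measurable. *)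
Lemma ae_fibre_measurable i p : dom F i p ->
  exists2 g : R -> R, measurable_fun [set: R] g &
    {ae mu, forall t, f (tangent i p t) = g t}.
Proof.
move=> ip; have [U [oU Up Ui pU]] := flat_box ip.
have [N [mN N0 Nae]] := ae_fibre_in_box oU Ui pU.
have oC : open (chart F i @` (U `&` dom F i)) by exact: open_chart_image.
have [|z [q [Uq iq] qz] nN] := open_measure2_gt0 oC _ mN N0.
  by exists (chart F i p); exists p.
exists (fun t => u (tangent i q t)).
  move=> _ B mB; rewrite setTI.
  have mA : measurable (u @^-1` B) by rewrite -[X in measurable X]setTI; exact: mu_u.
  exact: (measurable_tangent_preimage iq mA).
have := contrapT (fun h => nN (Nae z h)).
by move=> /(_ q Uq qz); apply: ae_imp => t ->.
Qed.

(** The holonomy along [g] makes [f] constant almost everywhere on the fibre over [g 0], and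
    a leaf over both [g 0] and [p] identifies the two fibres by a rotation, which
    preserves null sets. *)
Lemma ae_fibre_constant : non_rational_holonomy F ->
  exists k, forall i p, dom F i p -> {ae mu, forall t, f (tangent i p t) = k}.
Proof.
move=> [g [a [greg g01 gholo irr]]].
pose p0 := g 0.
have Sp0 : ~ sing F p0 by apply: greg.2; rewrite in_itv/= lexx ler01.
have [i0 ip0] := exists_chart Sp0.
have [h mh fh] := ae_fibre_measurable ip0.
have [|||k fk] := ae_constant_of_irrational_periods _ irr _ _ mh fh.
- by rewrite mulr_gt0// pi_gt0.
- move=> t; rewrite -rotate_tangent//; apply: f_leaf.
  exists g; split => //; apply: gholo.
  by rewrite base_tangent.
- by move=> t; rewrite tangentD2pi.
exists k => i p ip.
have [w [wp lw]] := leaf_over_regular (tangent i0 p0 0) (dom_regular ip).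
subst p; have [s ws] := dir_unit_vec ip.
apply: ae_imp (ae_shift (- s) fk) => t <-.
apply: f_leaf; have := leaf_rotate (t - s) lw.
rewrite rotate_tangent// add0r {1}(tangent_unique ip ws) rotate_tangent//.
by rewrite [s + _]addrC subrK.
Qed.

(** By compactness, the property [G A] that [u] equals [k] almost everywhere above
    [A] has only to be checked near each point; regular points have flat boxes, and what surrounds a cone
    point is exhausted by the compact annuli [K n]. *)
Lemma ae_constant_of_fibres k :
  (forall i p, dom F i p -> {ae mu, forall t, f (tangent i p t) = k}) ->
  {ae vol, forall v, u v = k}.
Proof.
move=> fk.
pose G (A : set F) := vol.-negligible [set v | A (base v) /\ u v <> k].
have G0 : G set0.
  rewrite /G (_ : [set _ | _] = set0); first exact: negligible_set0.
  by apply/seteqP; split => v [].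
have GS A B : A `<=` B -> G B -> G A.
  by move=> AB; apply: negligibleS => v [/AB].
have GU A B : G A -> G B -> G (A `|` B).
  move=> GA GB; apply: negligibleS (negligibleU GA GB) => v [[Av|Bv] uv];
    by [left|right].
have Gbox p : ~ sing F p -> exists2 U, nbhs p U & G U.
  move=> /exists_chart[i ip]; have [U [oU Up Ui pU]] := flat_box ip.
  exists U; first exact: open_near.
  pose A : set (tangent_borel F) := [set v | U (base v)] `&` (u @^-1` ~` [set k]).
  have mA : measurable A.
    apply: measurableI; first exact: measurable_over.
    by rewrite -[X in measurable X]setTI; apply: mu_u => //; exact: measurableC.
  have Ai : A `<=` [set v | dom F i (base v)] by move=> v [/Ui].
  exists A; split => //; apply/(volume_null volP mA Ai).
  apply: ae_imp (ae_fibre_in_box oU Ui pU) => z Uz q iq qz.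
  have [Uq|nUq] := pselect (U q); last first.
    by apply: aeW => t [/=]; rewrite base_tangent.
  apply: ae_imp2 (Uz q Uq qz) (fk i p ip) => t uft ftk.
  by move=> [_]; apply; rewrite /= uft.
have Gcone p : sing F p -> exists2 U, nbhs p U & G U.
  move=> Sp; have [r0 [c [r00 coneP]]] := sing_cone Sp.
  have [c0 _ _ _ [_ cnbhs]] := coneP.
  have hr : r0 / 2 < r0 by rewrite ltr_pdivrMr// ltr_pMr// ltr1n.
  exists (c @` [set z | 0 <= z.1 < r0 / 2]); first by apply: cnbhs; rewrite divr_gt0.
  pose K (n : nat) : set (R * R) := `[n.+1%:R^-1, r0 / 2] `*` `[- n%:R, n%:R].
  have KA n z : K n z -> annulus r0 z.
    move=> [/=]; rewrite in_itv/= => /andP[z1 z2] _; apply/andP; split.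
      by apply: lt_le_trans z1; rewrite invr_gt0.
    exact: le_lt_trans hr.
  have GK n : G (c @` K n).
    apply: (compact_local_property (G := G)) => //.
      apply: continuous_compact.
        apply: continuous_in_subspaceT => z /set_mem /KA; exact: cone_continuous_at coneP _.
      by apply: compact_setX; exact: segment_compact.
    by move=> _ [z /KA Az <-]; apply: Gbox; exact: cone_regular coneP _ Az.
  have : vol.-negligible (\bigcup_n [set v | (c @` K n) (base v) /\ u v <> k]).
    by apply: negligible_bigcup => n; exact: GK.
  apply: negligibleS => v [[[r t] /= /andP[r1 r2] cv] uv].
  have {}r1 : 0 < r.
    rewrite lt_neqAle r1 andbT; apply/eqP => r_0; apply: (base_regular (u := v)).
    by rewrite -cv -r_0 c0.
  (* an index of an annulus K n containing the polar coordinates of base v *)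
  have [n [n1 n2]] : exists n : nat, n.+1%:R^-1 <= r /\ `|t| <= n%:R.
    have [n nr] : exists n : nat, n.+1%:R^-1 < r.
      by have [n _ /(_ n (leqnn n))] := near_infty_natSinv_lt (PosNum r1); exists n.
    pose m := maxn n (Num.bound `|t|); exists m; split.
      apply: le_trans (ltW nr); rewrite lef_pV2 ?posrE// ler_nat ltnS; exact: leq_maxl.
    apply: le_trans (ltW (archi_boundP (normr_ge0 t))) _.
    rewrite ler_nat; exact: leq_maxr.
  exists n => //; split => //; exists (r, t) => //; split; rewrite /= in_itv/=.
    by rewrite n1 ltW.
  by rewrite -ler_norml.
have : G setT.
  apply: (compact_local_property (G := G)) => //; first exact: surface_compact.
  by move=> p _; have [Sp|Sp] := pselect (sing F p); [exact: Gcone|exact: Gbox].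
by apply: negligibleS => v /= uv; split.
Qed.

End AlmostInvariantFunction.

Lemma horizontal_ergodicity : non_rational_holonomy F -> horizontal_ergodic vol.
Proof.
move=> hol u uL /leaf_invariant_representative[f f_leaf uf].
have mu_u : measurable_fun setT u by have /sub_Lfun_mfun := uL; rewrite inE.
have [k fk] := ae_fibre_constant mu_u f_leaf uf hol.
by exists k; exact: ae_constant_of_fibres fk.
Qed.

End Ergodicity.

Theorem theorem1p2 (R : realType) (F : flatSurface R)
    (vol : {measure set (tangent_borel F) -> \bar R}) (hvol : is_volume vol) :
  ((exists2 p : F, sing F p & irrational (cone_angle p / (2 * pi))) ->
     non_rational_holonomy F) /\
  (non_rational_holonomy F -> horizontal_ergodic vol).
Proof.
split=> [[p Sp irr]|]; first exact: non_rational_cone irr.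
exact: horizontal_ergodicity.
Qed.
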